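(* Let $\mathcal H=\{(X,Y)\in\mathbb R^2:\ |X|\le\tfrac12,\ \sqrt3\,|Y|+|X|\le1\}$. Then $$\int_{t>0,\ (X,Y)\in\mathcal H,\ 1-1/t^4\le X^2+Y^2}t^3\,dt\,dX\,dY=\frac\pi2\log2-\frac{3\pi}8\log3+\frac32\Big(\operatorname{Im}L_2\Big(\frac{3-i\sqrt3}6\Big)+\operatorname{Im}L_2\Big(\frac{3+i\sqrt3}4\Big)\Big),$$ where $L_2(z)=\sum_{n=1}^\infty\frac{z^n}{n^2}$ is the dilogarithm.
   Context: The integral, denoted $\mathrm{vol}\,\widehat\Gamma_{\mathcal H}$ in the paper, is (up to the constant factor $2\pi^2$ coming from integration over $\mathrm{SU}(2)$) the volume for the invariant measure of $\mathrm{SL}_2(\mathbb C)$ of the set of shortest reduced bases over the Eisenstein integers, in Gram–Schmidt coordinates $\boldsymbol\alpha=(t,0)$, $\boldsymbol\beta=(t(X+iY),1/t)$. The set $\mathcal H$ is the regular hexagon of side $1/\sqrt3$ that is the Voronoi cell of the origin for the Eisenstein integers. *)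

(* Defs.v *)
From HB Require Import structures.
From mathcomp Require Import all_boot all_order all_algebra.
From mathcomp Require Import all_classical all_reals all_analysis.
From mathcomp Require Import complex.

Set Implicit Arguments.
Unset Strict Implicit.
Unset Printing Implicit Defensive.
Import Order.TTheory GRing.Theory Num.Theory numFieldNormedType.Exports.
Local Open Scope classical_set_scope.
Local Open Scope ring_scope.
Local Open Scope complex_scope.

(** Voronoi cell of the origin for the Eisenstein integers. *)
Definition hexagon (R : realType) : set (R * R) :=
  [set p | `|p.1| <= 2^-1 /\ Num.sqrt 3 * `|p.2| + `|p.1| <= 1].

(** Points are encoded as [(t, (X, Y))]. *)
Definition reduced_domain (R : realType) : set (R * (R * R)) :=
  [set p | [/\ 0 < p.1, hexagon p.2 &
               1 - 1 / p.1 ^+ 4 <= p.2.1 ^+ 2 + p.2.2 ^+ 2]].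

(** The product of two copies of [lebesgue_measure] is named so that it can be
    given a canonical sigma-finite measure structure: for a nested product
    [lebesgue_measure \x (lebesgue_measure \x lebesgue_measure)] no measure
    structure is inferred. *)
Definition lebesgue2 (R : realType) :
    set (measurableTypeR R * measurableTypeR R) -> \bar R :=
  (lebesgue_measure \x lebesgue_measure)%E.

HB.instance Definition _ (R : realType) :=
  Measure.copy (@lebesgue2 R) (lebesgue_measure \x lebesgue_measure)%E.

Lemma lebesgue2_sigma_finite (R : realType) : sigma_finite setT (@lebesgue2 R).
Proof.
have /sigma_finiteP[F [TF ndF Foo]] := sigma_finiteT (@lebesgue_measure R).
exists (fun n => F n `*` F n).
  rewrite -setXTT TF predeqE => -[x y]; split.
    move=> [/= [n _ Fnx] [k _ Fky]]; exists (maxn n k) => //; split.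
    - by move: x Fnx; exact/subsetPset/ndF/leq_maxl.
    - by move: y Fky; exact/subsetPset/ndF/leq_maxr.
  by move=> [n _ []/= ? ?]; split; exists n.
move=> k; have [? ?] := Foo k; split; first exact: measurableX.
by rewrite /lebesgue2 product_measure1E// lte_mul_pinfty// ge0_fin_numE.
Qed.

HB.instance Definition _ (R : realType) :=
  Measure_isSigmaFinite.Build _ _ _ (@lebesgue2 R)
    (@lebesgue2_sigma_finite R).

(** [R[i]^o] is [R[i]] seen as a normed module over itself: its topology is
    the one given by the complex modulus.  The series is indexed from 0, hence
    the shift [n.+1].  As usual with [limn], the value is meaningful only where
    the series converges, i.e. for [`|z| <= 1]. *)
Definition dilog (R : realType) (z : R[i]) : R[i] :=
  limn ([series (z ^+ n.+1 / n.+1%:R ^+ 2 : R[i]^o)]_n).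

(* Main.v *)
Require Import Defs.
From HB Require Import structures.
From mathcomp Require Import all_boot all_order all_algebra.
From mathcomp Require Import all_classical all_reals all_analysis.
From mathcomp Require Import measurable_realfun.
From mathcomp Require Import complex.
From mathcomp Require Import ring lra.
Import Order.TTheory GRing.Theory Num.Theory numFieldNormedType.Exports.
Local Open Scope classical_set_scope.
Local Open Scope ring_scope.
Local Open Scope complex_scope.
Set Implicit Arguments.
Unset Strict Implicit.
Unset Printing Implicit Defensive.

(** Write [w] for the square root of 3 and let [c] be the odd primitive of
    [ln (2 cos x)], a variant of the Clausen and Lobachevsky functions.  Both
    sides of the identity are elementary expressions in the single number
    [c (pi / 3) - 2 c (pi / 6)], and this is how they are compared.

    The volume.  Over a point of the hexagon at distance [r] from the origin,
    [t] ranges over the interval from 0 to [(1 - r^2)^(-1/4)], so integrating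
    [t^3] leaves [1 / (4 (1 - r^2))] to be integrated over the hexagon
    ([fiber_volumeE], [integral_reduced_domain]).  This is done in the
    coordinates [(x, u)] with slope [u = y / x], which play the role of polar
    coordinates but need only a linear change of variable at fixed [x]
    ([slope_coordinates]).  On the half-line of slope [u >= 0] the radial
    integral is a logarithm divided by [1 + u^2] ([radial_integral]).  With
    [u = tan theta], the argument of that logarithm factors as a quotient of
    cosines of translates of [theta], so the remaining integral over [u] is a
    combination of values of [c].  The half-line leaves the hexagon through a
    vertical edge when [u <= 1 / w] ([integral_flat_slopes]) and through an
    oblique one when [u >= 1 / w] ([integral_steep_slopes]).  The total is
    [- 3/2 (c (pi / 3) - 2 c (pi / 6))] ([hexagon_volume]).

    The dilogarithms.  The two points are [w^-1 exp (- i pi / 6)] and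
    [w / 2 exp (i pi / 6)], hence up to conjugation they lie on the same ray.
    The two imaginary parts therefore add up to the increment, between
    [r = w^-1] and [r = w / 2], of
    [L r = sum sin (n pi / 6) r^n / n^2] ([Im_dilog_points]), and
    differentiating this power series twice gives
    [L' r = atan (r / (2 - w r)) / r] ([is_derive_sin_dilog_pi6]).  The
    substitution [r = sin a / sin (a + pi / 6)] turns the arctangent into [a]
    and the interval into [pi / 6 <= a <= pi / 3]; integrating [a d(ln r)] by
    parts leaves the integral of [ln r], a difference of two terms
    [ln (2 cos)], that is, [c (pi / 3) - 2 c (pi / 6)] again
    ([ray_increment]). *)

(** * Trigonometric constants *)

Lemma sqrt3_sqr (R : realType) : (Num.sqrt 3 : R) ^+ 2 = 3.
Proof. by rewrite sqr_sqrtr. Qed.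

Lemma sqrt3_gt0 (R : realType) : 0 < Num.sqrt 3 :> R.
Proof. by rewrite sqrtr_gt0. Qed.

Lemma sin_pi6 (R : realType) : sin (pi / 6) = 1 / 2 :> R.
Proof.
have h : 0 < (pi : R) := pi_gt0 R.
set x : R := pi / 6.
have : sin (x + (x + x)) = 1.
  by rewrite -(@sin_pihalf R); congr sin; rewrite /x; field.
have := cos2Dsin2 x.
have : 0 < sin x by apply: sin_gt0_pi; rewrite /x; lra.
rewrite sinD sinD cosD; set s := sin x; set c := cos x => s0 cs E.
(* The triple angle formula turns sin (3 x) = 1 into this factored cubic. *)
have : (s + 1) * (2 * s - 1) ^+ 2 = 0 by nra.
move=> /eqP; rewrite mulf_eq0 sqrf_eq0 => /orP[|] /eqP; lra.
Qed.

Lemma cos_pi6 (R : realType) : cos (pi / 6) = Num.sqrt 3 / 2 :> R.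
Proof.
have h : 0 < (pi : R) := pi_gt0 R.
have : 0 < cos (pi / 6) :> R by apply: cos_gt0_pihalf; lra.
have := cos2Dsin2 (pi / 6 : R); rewrite sin_pi6.
have := sqrt3_sqr R; have := sqrt3_gt0 R; nra.
Qed.

Lemma cos_pi3 (R : realType) : cos (pi / 3) = 1 / 2 :> R.
Proof.
have -> : pi / 3 = pi / 6 + pi / 6 :> R by field.
rewrite cosD cos_pi6 sin_pi6; have := sqrt3_sqr R; nra.
Qed.

Lemma sin_pi3 (R : realType) : sin (pi / 3) = Num.sqrt 3 / 2 :> R.
Proof.
have -> : pi / 3 = pi / 6 + pi / 6 :> R by field.
rewrite sinD cos_pi6 sin_pi6; lra.
Qed.

(** * Calculus in one variable *)

(** The rules are stated for functions written as lambda-terms rather than for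
    sums and products of functions, so that they apply to formulas by
    matching. *)
Section derivation_rules.
Context {R : realType}.
Implicit Types (f g : R -> R) (x a b k : R).

Lemma is_derive_lam_cst x k : is_derive x 1 (fun=> k) 0.
Proof. exact: is_derive_cst. Qed.

Lemma is_derive_lam_id x : is_derive x 1 (fun y => y) 1.
Proof. exact: is_derive_id. Qed.

Lemma is_derive_lam_add f g x a b : is_derive x 1 f a -> is_derive x 1 g b ->
  is_derive x 1 (fun y => f y + g y) (a + b).
Proof. exact: is_deriveD. Qed.

Lemma is_derive_lam_opp f x a : is_derive x 1 f a ->
  is_derive x 1 (fun y => - f y) (- a).
Proof. exact: is_deriveN. Qed.

Lemma is_derive_lam_mul f g x a b : is_derive x 1 f a -> is_derive x 1 g b ->
  is_derive x 1 (fun y => f y * g y) (f x * b + g x * a).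
Proof. exact: is_deriveM. Qed.

Lemma is_derive_lam_exp f n x a : is_derive x 1 f a ->
  is_derive x 1 (fun y => f y ^+ n) (n%:R * f x ^+ n.-1 * a).
Proof. by move=> df; rewrite -exprfctE; exact: is_deriveX. Qed.

Lemma is_derive_lam_inv f x a : f x != 0 -> is_derive x 1 f a ->
  is_derive x 1 (fun y => (f y)^-1) (- a / f x ^+ 2).
Proof.
move=> fx0 df; apply: DeriveDef; first exact: derivableV.
by rewrite deriveV// derive_val /GRing.scale/=; field.
Qed.

Lemma is_derive_lam_comp f g x a b :
  is_derive (g x) 1 f a -> is_derive x 1 g b ->
  is_derive x 1 (fun y => f (g y)) (a * b).
Proof. exact: is_derive1_comp. Qed.

Lemma is_derive_lam_ln f x a : 0 < f x -> is_derive x 1 f a ->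
  is_derive x 1 (fun y => ln (f y)) ((f x)^-1 * a).
Proof.
by move=> fx0; apply: (@is_derive_lam_comp (@ln R) f); exact: is_derive1_ln.
Qed.

Lemma is_derive_lam_sin f x a : is_derive x 1 f a ->
  is_derive x 1 (fun y => sin (f y)) (cos (f x) * a).
Proof. exact: (@is_derive_lam_comp (@sin R) f). Qed.

Lemma is_derive_lam_cos f x a : is_derive x 1 f a ->
  is_derive x 1 (fun y => cos (f y)) (- sin (f x) * a).
Proof. exact: (@is_derive_lam_comp (@cos R) f). Qed.

Lemma is_derive_lam_atan f x a : is_derive x 1 f a ->
  is_derive x 1 (fun y => atan (f y)) ((1 + f x ^+ 2)^-1 * a).
Proof. exact: (@is_derive_lam_comp (@atan R) f). Qed.

End derivation_rules.

(** Leaves the side conditions of inverse and logarithm, the derivatives of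
    unknown functions, and the comparison with the announced derivative.  Type
    class resolution is kept out because it would fill in derivatives in the
    pointwise form of the library, which [field] does not see through. *)
Ltac differentiate :=
  notypeclasses refine (is_derive_eq _ _);
  [ repeat first [ eassumption
                 | notypeclasses refine (is_derive_lam_cst _ _)
                 | notypeclasses refine (is_derive_lam_id _)
                 | notypeclasses refine (is_derive_lam_opp _)
                 | notypeclasses refine (is_derive_lam_sin _)
                 | notypeclasses refine (is_derive_lam_cos _)
                 | notypeclasses refine (is_derive_lam_atan _)
                 | notypeclasses refine (is_derive_lam_add _ _)
                 | notypeclasses refine (is_derive_lam_mul _ _)
                 | notypeclasses refine (is_derive_lam_exp _ _)
                 | notypeclasses refine (is_derive_lam_inv _ _)
                 | notypeclasses refine (is_derive_lam_ln _ _) ]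
  | cbv beta ].

Lemma is_derive_continuous (R : realType) (f : R -> R) (x d : R) :
  is_derive x 1 f d -> {for x, continuous f}.
Proof.
by move=> df; apply: differentiable_continuous; exact/derivable1_diffP.
Qed.

Lemma derive0_eq (R : realType) (f : R -> R) (a b : R) : a <= b ->
  (forall x : R, a <= x <= b -> is_derive x 1 f 0) -> f a = f b.
Proof.
move=> ab df; have [| |c _] := @MVT_segment R f (fun=> 0) a b ab.
- by move=> x; rewrite in_itv/= => /andP[? ?]; apply: df; rewrite !ltW.
- apply: continuous_in_subspaceT => x; rewrite inE/= in_itv/= => /df.
  exact: is_derive_continuous.
- by rewrite mul0r => /subr0_eq.
Qed.

Lemma integral_is_derive (R : realType) (f F : R -> R) (a b : R) : a < b ->
  (forall x : R, a <= x <= b -> {for x, continuous f}) ->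
  (forall x : R, a <= x <= b -> is_derive x 1 F (f x)) ->
  (\int[lebesgue_measure]_(x in `[a, b]) (f x)%:E = (F b - F a)%:E)%E.
Proof.
move=> ab cf dF; rewrite (@continuous_FTC2 R f F)//.
- by apply: continuous_in_subspaceT => x; rewrite inE/= in_itv/= => /cf.
- split.
  + by move=> x; rewrite in_itv/= => /andP[? ?]; apply: ex_derive; apply: dF;
      rewrite !ltW.
  + apply: cvg_at_right_filter; apply: is_derive_continuous; apply: dF.
    by rewrite lexx ltW.
  + apply: cvg_at_left_filter; apply: is_derive_continuous; apply: dF.
    by rewrite lexx ltW.
- move=> x; rewrite in_itv/= => /andP[? ?]; rewrite derive1E.
  by apply: derive_val; apply: dF; rewrite !ltW.
Qed.

Lemma integral_is_derivey (R : realType) (f F : R -> R) (a l : R) :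
  (forall x : R, a <= x -> 0 <= f x) ->
  (forall x : R, a <= x -> {for x, continuous f}) ->
  (forall x : R, a <= x -> is_derive x 1 F (f x)) ->
  F x @[x --> +oo] --> l ->
  (\int[lebesgue_measure]_(x in `[a, +oo[) (f x)%:E = (l - F a)%:E)%E.
Proof.
move=> f0 cf dF Fl; rewrite (ge0_continuous_FTC2y f0 _ Fl)//.
- apply: continuous_in_subspaceT => x; rewrite inE/= in_itv/= andbT => /cf.
  exact.
- by move=> x ax; apply: ex_derive; apply: dF; exact: ltW.
- apply: cvg_at_right_filter; apply: is_derive_continuous; exact: dF.
- move=> x; rewrite in_itv/= andbT => ax; rewrite derive1E.
  by apply: derive_val; apply: dF; exact: ltW.
Qed.

Lemma primitive_itv (R : realType) (f : R -> R) (a b : R) : a < b ->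
  (forall x : R, a <= x <= b -> {for x, continuous f}) ->
  exists F : R -> R, forall x : R, a < x < b -> is_derive x 1 F (f x).
Proof.
move=> ab cf.
have fi : lebesgue_measure.-integrable `[a, b] (EFin \o f).
  apply: continuous_compact_integrable; first exact: segment_compact.
  by apply: continuous_in_subspaceT => x; rewrite inE/= in_itv/= => /cf.
exists (fun x => \int[lebesgue_measure]_(t in `[a, x]) f t)%R => x /andP[ax xb].
have := @continuous_FTC1_closed R f a x b xb fi ax.
have /cf cfx : a <= x <= b by rewrite !ltW.
move=> /(_ cfx)[dF F'].
by rewrite -F' derive1E; exact: derivableP.
Qed.

(** * The Clausen-type primitive and the increment along the ray *)

(** The interval is where all the arguments of [c] lie below, endpoints
    included; the two-sided derivative at the endpoints makes sense because
    [2 cos] is still positive slightly beyond. *)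
Definition odd_primitive_logcos (R : realType) (c : R -> R) :=
  (forall x, c (- x) = - c x) /\
  (forall x : R, - (pi / 3) <= x <= pi / 3 ->
     is_derive x 1 c (ln (2 * cos x))).

Lemma odd_primitive_logcos_exists (R : realType) :
  exists c : R -> R, odd_primitive_logcos c.
Proof.
have h : 0 < (pi : R) := pi_gt0 R.
(* Any number strictly between pi / 3 and pi / 2 will do. *)
pose a : R := 5 * pi / 12.
have cont x : - a <= x <= a ->
    {for x, continuous (fun y : R => ln (2 * cos y))}.
  rewrite /a => xa.
  have cx : 0 < cos x by apply: cos_gt0_pihalf; lra.
  by eapply is_derive_continuous; differentiate; [lra|reflexivity].
have [|F dF] := @primitive_itv R _ (- a) a _ cont; first by rewrite /a; lra.
(* The odd part of any primitive is a primitive since the integrand is even. *)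
exists (fun x => 2^-1 * (F x - F (- x))); split => [x|x xa].
  by rewrite opprK; ring.
have dx : is_derive x 1 F (ln (2 * cos x)) by apply: dF; rewrite /a; lra.
have dNx : is_derive (- x) 1 F (ln (2 * cos x)).
  by rewrite -(cosN x); apply: dF; rewrite /a; lra.
differentiate; first exact: (@is_derive_lam_comp _ F -%R).
by field.
Qed.

Lemma sinDpi6 (R : realType) (a : R) :
  sin (a + pi / 6) = (Num.sqrt 3 * sin a + cos a) / 2.
Proof. by rewrite sinD cos_pi6 sin_pi6; field. Qed.

(** Along the curve [s a = sin a / sin (a + pi / 6)] the arctangent equals [a],
    so that [L (s a)] has derivative [a (ln s)'].  Integration by parts is
    carried out by checking that
    [L (s a) - a ln (s a) - c (pi / 2 - a) - c (a - pi / 3)] is constant: the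
    derivative of the last two terms is [ln (s a)], because
    [cos (pi / 2 - a) = sin a] and [cos (a - pi / 3) = sin (a + pi / 6)]. *)
Lemma ray_increment (R : realType) (L c : R -> R) :
  odd_primitive_logcos c ->
  (forall r : R, 0 < r < 1 ->
     is_derive r 1 L (atan (r / (2 - Num.sqrt 3 * r)) / r)) ->
  L (Num.sqrt 3 / 2) - L (Num.sqrt 3)^-1 =
    pi / 3 * ln (Num.sqrt 3 / 2) + pi / 12 * ln 3
    + 2 * c (pi / 6) - c (pi / 3).
Proof.
move=> [codd dc] dL.
have h : 0 < (pi : R) := pi_gt0 R.
have w0 := sqrt3_gt0 R; have ww := sqrt3_sqr R.
pose q (a : R) := ln (sin a) - ln (sin (a + pi / 6)).
pose H (a : R) := L (sin a / sin (a + pi / 6)) - a * q a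
  - c (pi / 2 - a) - c (a - pi / 3).
have HH : H (pi / 6) = H (pi / 3).
  apply: derive0_eq => [|a a36]; first lra.
  have s0 : 0 < sin a by apply: sin_gt0_pihalf; lra.
  have c0 : 0 < cos a by apply: cos_gt0_pihalf; lra.
  have sp0 : 0 < sin (a + pi / 6) by rewrite sinDpi6; nra.
  have sp1 : sin a < sin (a + pi / 6).
    by rewrite ltr_sin ?in_itv/=; lra.
  have dLs := dL (sin a / sin (a + pi / 6))
    ltac:(by rewrite divr_gt0// ltr_pdivrMr// mul1r).
  have dc1 := dc (pi / 2 - a) ltac:(lra).
  have dc2 := dc (a - pi / 3) ltac:(lra).
  (* The right-hand side is sin ((a + pi / 6) - a). *)
  have E : 2^-1 = cos a * sin (a + pi / 6) - sin a * cos (a + pi / 6).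
    transitivity ((cos a ^+ 2 + sin a ^+ 2) / 2).
      by rewrite cos2Dsin2 mul1r.
    by rewrite sinD cosD cos_pi6 sin_pi6; field.
  have ds : is_derive a 1 (fun y => sin y / sin (y + pi / 6))
      (2^-1 / sin (a + pi / 6) ^+ 2).
    differentiate; first by rewrite gt_eqF.
    by rewrite E; field; rewrite gt_eqF.
  rewrite /H /q; differentiate.
  - exact: (is_derive_lam_comp (g := fun y => sin y / sin (y + pi / 6)) dLs ds).
  - exact: (is_derive_lam_comp (g := fun y => pi / 2 - y) dc1).
  - exact: (is_derive_lam_comp (g := fun y => y - pi / 3) dc2).
  have -> : cos (pi / 2 - a) = sin a.
    by rewrite cosB cos_pihalf sin_pihalf; ring.
  have -> : cos (a - pi / 3) = sin (a + pi / 6).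
    by rewrite cosB cos_pi3 sin_pi3 sinDpi6; ring.
  have -> : sin a / sin (a + pi / 6) /
      (2 - Num.sqrt 3 * (sin a / sin (a + pi / 6))) = tan a.
    have -> : 2 - Num.sqrt 3 * (sin a / sin (a + pi / 6)) =
        cos a / sin (a + pi / 6).
      have <- : 2 * sin (a + pi / 6) - Num.sqrt 3 * sin a = cos a.
        by rewrite sinDpi6; field.
      by field; rewrite gt_eqF.
    by rewrite /tan; field; rewrite !gt_eqF.
  rewrite tanK ?in_itv/=; last lra.
  rewrite !lnM ?posrE//.
  have sp0' : sin (a + pi / 6) != 0 by rewrite gt_eqF.
  have s0' : sin a != 0 by rewrite gt_eqF.
  by rewrite E; field; rewrite sp0'.
move: HH; rewrite /H /q.
have -> : pi / 3 + pi / 6 = pi / 2 :> R by field.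
have -> : pi / 6 + pi / 6 = pi / 3 :> R by field.
have -> : pi / 2 - pi / 3 = pi / 6 :> R by field.
have -> : pi / 2 - pi / 6 = pi / 3 :> R by field.
have -> : pi / 6 - pi / 3 = - (pi / 6) :> R by field.
rewrite subrr codd.
have c0 : c 0 = 0 by have := codd 0; rewrite oppr0; lra.
rewrite sin_pi6 sin_pi3 sin_pihalf !divr1 ln1.
have -> : 1 / 2 / (Num.sqrt 3 / 2) = (Num.sqrt 3)^-1 :> R.
  by field; rewrite gt_eqF.
have -> : ln 3 = 2 * ln (Num.sqrt 3) :> R.
  by rewrite -{1}ww expr2 lnM ?posrE//; ring.
rewrite !ln_div ?posrE// ln1 => HH.
by rewrite c0 in HH; lra.
Qed.

(** * The dilogarithm along a ray *)

(** The geometric sum [1 + q + .. + q^n] has [n + 1] terms, each at least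
    [q^n]. *)
Lemma natr_succ_expr_le (R : realType) (q : R) n : 0 < q < 1 ->
  n.+1%:R * q ^+ n <= (1 - q)^-1.
Proof.
move=> /andP[q0 q1]; have q1' : 0 < 1 - q by rewrite subr_gt0.
apply: (@le_trans _ _ (\sum_(0 <= i < n.+1) q ^+ i)).
  rewrite mulr_natl -[X in _ *+ X]subn0 -sumr_const_nat.
  apply: ler_sum_nat => i /= /ltnSE ni.
  by apply: ler_wiXn2l => //; exact: ltW.
rewrite -[leRHS]mul1r ler_pdivlMr//.
have := subrXX 1 q n.+1.
rewrite expr1n => E.
have -> : (\sum_(0 <= i < n.+1) q ^+ i) * (1 - q) = 1 - q ^+ n.+1.
  rewrite E mulrC big_mkord; congr (_ * _).
  by apply: eq_bigr => i _; rewrite expr1n mul1r.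
by rewrite gerBl exprn_ge0// ltW.
Qed.

(** Compared with a geometric series of ratio [q], where [q^2] is the midpoint
    of [|x|] and 1: one factor [q^n] absorbs the growth of the coefficients and
    the other one remains. *)
Lemma cvg_pseries_linear (R : realType) (f : nat -> R) (x : R) :
  (forall n, `|f n| <= n.+1%:R) -> `|x| < 1 -> cvgn (pseries f x).
Proof.
move=> fn x1.
pose q := Num.sqrt ((1 + `|x|) / 2).
have x0 := normr_ge0 x.
have qq : q ^+ 2 = (1 + `|x|) / 2 by rewrite sqr_sqrtr// divr_ge0// addr_ge0.
have q0 : 0 < q by rewrite sqrtr_gt0 divr_gt0// ltr_pwDl.
have q1 : q < 1 by nra.
apply: normed_cvg.
apply: (@series_le_cvg _ _ (geometric (1 - q)^-1 q)) => //=.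
- by move=> n; rewrite mulr_ge0// ?invr_ge0 ?subr_ge0 ?exprn_ge0// ltW.
- move=> n; rewrite normrM normrX.
  apply: (@le_trans _ _ (n.+1%:R * (q ^+ 2) ^+ n)).
    apply: ler_pM; rewrite ?exprn_ge0//.
    by apply: lerXn2r; rewrite ?nnegrE// ?exprn_ge0// ?ltW// qq; lra.
  rewrite -exprM mul2n -addnn exprD mulrA ler_wpM2r//.
    by rewrite exprn_ge0// ltW.
  by apply: natr_succ_expr_le; rewrite q0.
- by apply: is_cvg_geometric_series; rewrite gtr0_norm.
Qed.

Lemma is_derive_pseries_linear (R : realType) (f : nat -> R) (x : R) :
  (forall n, `|f n| <= n.+1%:R) ->
  (forall n, `|pseries_diffs f n| <= n.+1%:R) ->
  (forall n, `|pseries_diffs (pseries_diffs f) n| <= n.+1%:R) ->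
  `|x| < 1 ->
  is_derive x 1 (fun y => limn (pseries f y))
    (limn (pseries (pseries_diffs f) x)).
Proof.
move=> f0 f1 f2 x1; have x0 := normr_ge0 x.
apply: (@pseries_snd_diffs _ _ ((1 + `|x|) / 2)).
- by apply: cvg_pseries_linear => //; rewrite ger0_norm; lra.
- by apply: cvg_pseries_linear => //; rewrite ger0_norm; lra.
- by apply: cvg_pseries_linear => //; rewrite ger0_norm; lra.
- by rewrite [ltRHS]ger0_norm; lra.
Qed.

(** The value at [n = 0] is 0, so that the sums below can be power series in
    which the constant term does not count. *)
Definition sin_div_pow (R : realType) (phi : R) (k n : nat) : R :=
  sin (n%:R * phi) / n%:R ^+ k.

Lemma sin_div_pow0 (R : realType) (phi : R) k : sin_div_pow phi k 0 = 0.
Proof. by rewrite /sin_div_pow mul0r sin0 mul0r. Qed.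

Lemma pseries_diffs_sin_div_pow (R : realType) (phi : R) k :
  pseries_diffs (sin_div_pow phi k.+1) = fun n => sin_div_pow phi k n.+1.
Proof.
apply/funext => n; rewrite /pseries_diffs /sin_div_pow exprS.
have : n.+1%:R != 0 :> R by [].
move: (n.+1%:R : R) => m m0; field; by rewrite expf_neq0 m0.
Qed.

Lemma sin_div_pow_le1 (R : realType) (phi : R) k n :
  `|sin_div_pow phi k n| <= 1.
Proof.
case: n => [|n]; first by rewrite sin_div_pow0 normr0.
rewrite /sin_div_pow normrM normfV normrX normr_nat.
rewrite ler_pdivrMr ?exprn_gt0// mul1r (le_trans (sin_max _))//.
by rewrite exprn_ege1// ler1n.
Qed.

Lemma sin_div_pow_le (R : realType) (phi : R) k n m :
  `|sin_div_pow phi k n| <= m.+1%:R.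
Proof. by rewrite (le_trans (sin_div_pow_le1 _ _ _))// ler1n. Qed.

Lemma pseries_diffs_sin_div_pow_le (R : realType) (phi : R) k n :
  `|pseries_diffs (fun n => sin_div_pow phi k n.+1) n| <= n.+1%:R.
Proof.
by rewrite /pseries_diffs normrM normr_nat ler_piMr// sin_div_pow_le1.
Qed.

(** For [0 <= r < 1] this is the imaginary part of the polylogarithm of order
    [k] at the point of modulus [r] and argument [phi]; it is studied as a
    function of [r]. *)
Definition sin_polylog (R : realType) (phi : R) (k : nat) (r : R) : R :=
  limn (pseries (sin_div_pow phi k) r).

Lemma cvg_sin_polylog (R : realType) (phi : R) k (r : R) : `|r| < 1 ->
  pseries (sin_div_pow phi k) r @ \oo --> sin_polylog phi k r.
Proof.
by move=> r1; apply: cvg_pseries_linear => // n; exact: sin_div_pow_le.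
Qed.

Lemma sin_polylog0 (R : realType) (phi : R) k : sin_polylog phi k 0 = 0.
Proof.
apply/cvg_lim => //; apply: (cvg_trans _ (@cvg_cst _ (0 : R) nat \oo _)).
apply: near_eq_cvg; near=> n.
rewrite /pseries/series/= big1// => -[|i] _; rewrite ?sin_div_pow0 ?mul0r//.
by rewrite exprS mul0r mulr0.
Unshelve. all: by end_near. Qed.

Lemma cvg_pseries_sin_div_powS (R : realType) (phi : R) k (r : R) : `|r| < 1 ->
  [series sin_div_pow phi k n.+1 * r ^+ n.+1]_n @ \oo --> sin_polylog phi k r.
Proof.
move=> /(@cvg_sin_polylog _ phi k); rewrite -cvg_shiftS.
apply: cvg_trans; apply: near_eq_cvg; near=> n.
by rewrite /pseries/series/= big_nat_recl//= sin_div_pow0 mul0r add0r.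
Unshelve. all: by end_near. Qed.

Lemma is_derive_sin_polylog (R : realType) (phi : R) k (r : R) : `|r| < 1 ->
  is_derive r 1 (sin_polylog phi k.+1)
    (limn [series sin_div_pow phi k n.+1 * r ^+ n]_n).
Proof.
move=> r1; have := @is_derive_pseries_linear _ (sin_div_pow phi k.+1) r.
rewrite pseries_diffs_sin_div_pow; apply => // n; [exact: sin_div_pow_le..|].
exact: pseries_diffs_sin_div_pow_le.
Qed.

(** Telescoping, by the recurrence
    [sin ((n+2) phi) = 2 cos phi sin ((n+1) phi) - sin (n phi)]. *)
Lemma sin_geometric_series (R : realType) (phi r : R) n :
  (\sum_(0 <= i < n) sin (i.+1%:R * phi) * r ^+ i)
    * (1 - 2 * r * cos phi + r ^+ 2) =
  sin phi - r ^+ n * sin (n.+1%:R * phi) + r ^+ n.+1 * sin (n%:R * phi).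
Proof.
elim: n => [|n IH].
  by rewrite big_nil !mul0r sin0 !mul1r; ring.
rewrite big_nat_recr//= mulrDl IH.
have -> : sin (n.+2%:R * phi) =
    2 * cos phi * sin (n.+1%:R * phi) - sin (n%:R * phi).
  have -> : n.+2%:R * phi = n.+1%:R * phi + phi by rewrite -natr1; ring.
  have -> : n%:R * phi = n.+1%:R * phi - phi by rewrite -natr1; ring.
  by rewrite sinD sinB; ring.
by rewrite !exprS; ring.
Qed.

Lemma lim_sin_geometric (R : realType) (phi r : R) : `|r| < 1 ->
  limn [series sin_div_pow phi 0 n.+1 * r ^+ n]_n =
    sin phi / (1 - 2 * r * cos phi + r ^+ 2).
Proof.
move=> r1.
(* The denominator is at least (1 - |r|)^2. *)
have D0 : 0 < 1 - 2 * r * cos phi + r ^+ 2.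
  have : r * cos phi <= `|r|.
    by rewrite (le_trans (ler_norm _))// normrM ler_piMr// cos_max.
  by rewrite -(real_normK (num_real r)); move: r1; nra.
have sin_cvg0 k : r ^+ n * sin ((n + k)%:R * phi) @[n --> \oo] --> (0 : R).
  apply/cvgr0Pnorm_lt => e e0.
  have /cvgr0Pnorm_lt /(_ _ e0) := cvg_expr r1.
  apply: filterS => n; apply: le_lt_trans.
  by rewrite normrM ler_piMr// sin_max.
apply/cvg_lim => //.
have H : (sin phi - r ^+ n * sin ((n + 1)%:R * phi)
       + r * (r ^+ n * sin ((n + 0)%:R * phi)))
         / (1 - 2 * r * cos phi + r ^+ 2) @[n --> \oo] -->
       (sin phi - 0 + r * 0) / (1 - 2 * r * cos phi + r ^+ 2).
  apply: cvgM; last exact: cvg_cst.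
  apply: cvgD; first by apply: cvgB; [exact: cvg_cst|exact: sin_cvg0].
  by apply: cvgM; [exact: cvg_cst|exact: sin_cvg0].
rewrite mulr0 addr0 subr0 in H; apply: cvg_trans H; apply: near_eq_cvg.
near=> n; rewrite addn1 addn0 mulrA -exprS -sin_geometric_series.
rewrite mulfK ?gt_eqF//.
by apply: eq_bigr => i _ /=; rewrite /sin_div_pow divr1.
Unshelve. all: by end_near. Qed.

(** Both sides vanish at 0 and have derivative
    [sin phi / (1 - 2 r cos phi + r^2)].  The right-hand side is the argument of
    [1 / (1 - r exp (i phi))]. *)
Lemma sin_polylog1E (R : realType) (phi r : R) : 0 <= r < 1 ->
  sin_polylog phi 1 r = atan (r * sin phi / (1 - r * cos phi)).
Proof.
move=> /andP[r0 r1].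
pose g (s : R) := sin_polylog phi 1 s - atan (s * sin phi / (1 - s * cos phi)).
suff : g 0 = g r.
  by rewrite /g sin_polylog0 !mul0r atan0 subrr => /esym/subr0_eq.
apply: derive0_eq => // s /andP[s0 sr].
have s1 : `|s| < 1 by rewrite ger0_norm// (le_lt_trans sr).
have D0 : 0 < 1 - s * cos phi.
  have := cos_le1 phi; move: s1; rewrite ltr_norml; nra.
have dp := @is_derive_sin_polylog _ phi 0 s s1.
rewrite lim_sin_geometric// in dp.
rewrite /g; differentiate; first by rewrite gt_eqF.
have -> : 1 - 2 * s * cos phi + s ^+ 2 =
    (1 - s * cos phi) ^+ 2 + (s * sin phi) ^+ 2.
  by rewrite exprMn sin2cos2; ring.
field.
by rewrite !gt_eqF//= ltr_pwDl ?sqr_ge0// exprn_gt0.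
Qed.

Lemma is_derive_sin_dilog (R : realType) (phi r : R) : 0 < r < 1 ->
  is_derive r 1 (sin_polylog phi 2)
    (atan (r * sin phi / (1 - r * cos phi)) / r).
Proof.
move=> /andP[r0 r1]; have nr1 : `|r| < 1 by rewrite gtr0_norm.
rewrite -sin_polylog1E ?(ltW r0)//.
suff <- : limn [series sin_div_pow phi 1 n.+1 * r ^+ n]_n =
    sin_polylog phi 1 r / r.
  exact: is_derive_sin_polylog.
apply/cvg_lim => //.
have H : [series sin_div_pow phi 1 n.+1 * r ^+ n.+1]_n n / r @[n --> \oo] -->
    sin_polylog phi 1 r / r.
  by apply: cvgM; [exact: cvg_pseries_sin_div_powS|exact: cvg_cst].
apply: cvg_trans H; apply: near_eq_cvg; near=> n.
rewrite /series/= mulr_suml; apply: eq_bigr => i _.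
by rewrite exprS; field; rewrite gt_eqF.
Unshelve. all: by end_near. Qed.

Lemma sin_polylogN (R : realType) (phi r : R) k : `|r| < 1 ->
  sin_polylog (- phi) k r = - sin_polylog phi k r.
Proof.
move=> r1; apply/cvg_lim => //.
have H : - pseries (sin_div_pow phi k) r n @[n --> \oo] -->
    - sin_polylog phi k r by apply: cvgN; exact: cvg_sin_polylog.
apply: cvg_trans H; apply: near_eq_cvg; near=> n.
rewrite /pseries/series/= -sumrN; apply: eq_bigr => i _.
by rewrite /sin_div_pow mulrN sinN !mulNr.
Unshelve. all: by end_near. Qed.

Lemma cvg_complex (R : realType) (u v : nat -> R) (a b : R) :
  u @ \oo --> a -> v @ \oo --> b ->
  ((u n +i* v n : R[i]^o) @[n --> \oo] --> (a +i* b : R[i]^o)).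
Proof.
move=> ua vb.
have norm_le (x y : R) : `|x +i* y| <= (`|x| + `|y|)%:C.
  rewrite normc_def lecR/= -[leRHS]ger0_norm ?addr_ge0// -sqrtr_sqr.
  rewrite ler_sqrt ?sqr_ge0// sqrrD !real_normK ?num_real//.
  by rewrite addrAC lerDl mulrn_wge0// mulr_ge0.
apply/cvgrPdist_lt => e e0.
have eE : e = (complex.Re e)%:C by rewrite RRe_real// gtr0_real.
have e2 : 0 < complex.Re e / 2.
  by move: e0; rewrite eE ltcR => e0; rewrite divr_gt0.
have /cvgrPdist_lt /(_ _ e2) ua' := ua.
have /cvgrPdist_lt /(_ _ e2) vb' := vb.
near=> n.
have -> : (a +i* b) - (u n +i* v n) = (a - u n) +i* (b - v n) :> R[i] by [].
apply: (le_lt_trans (norm_le _ _)); rewrite eE ltcR (splitr (complex.Re e)).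
by apply: ltrD; near: n.
Unshelve. all: by end_near. Qed.

Lemma complex_polarX (R : realType) (r phi : R) n :
  (r%:C * (cos phi +i* sin phi)) ^+ n =
  (r ^+ n * cos (n%:R * phi)) +i* (r ^+ n * sin (n%:R * phi)).
Proof.
elim: n => [|n IH]; first by rewrite !mul0r cos0 sin0 mulr1 mulr0.
rewrite exprS IH -natr1 mulrDl mul1r cosD sinD.
rewrite exprS; simpc.
by apply/eqP; rewrite eq_complex/=; apply/andP; split; apply/eqP; ring.
Qed.

Lemma Im_dilog_polar (R : realType) (r phi : R) : 0 <= r < 1 ->
  complex.Im (dilog (r%:C * (cos phi +i* sin phi))) = sin_polylog phi 2 r.
Proof.
move=> /andP[r0 r1]; have nr1 : `|r| < 1 by rewrite ger0_norm.
pose cos_coef n : R := cos (n%:R * phi) / n%:R ^+ 2.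
pose u n : R := \sum_(0 <= i < n) cos_coef i.+1 * r ^+ i.+1.
pose v n : R := \sum_(0 <= i < n) sin_div_pow phi 2 i.+1 * r ^+ i.+1.
have vl : v @ \oo --> sin_polylog phi 2 r by exact: cvg_pseries_sin_div_powS.
have ul : cvgn u.
  have -> : u = (fun n => r * pseries (fun i => cos_coef i.+1) r n).
    apply/funext => n; rewrite /u /pseries/series/= mulr_sumr.
    by apply: eq_bigr => i _; rewrite exprS mulrCA.
  apply: is_cvgM; first exact: is_cvg_cst.
  apply: cvg_pseries_linear => // n.
  rewrite /cos_coef normrM normfV normrX normr_nat ler_pdivrMr ?exprn_gt0//.
  by rewrite (le_trans (cos_max _))// -natrX -natrM ler1n muln_gt0.
have E : [series ((r%:C * (cos phi +i* sin phi)) ^+ n.+1 / n.+1%:R ^+ 2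
    : R[i]^o)]_n = (fun n => u n +i* v n).
  apply/funext; rewrite /series/=; elim=> [|n IH].
    by rewrite /u /v !big_nil.
  rewrite big_nat_recr//= IH /u /v !big_nat_recr//= complex_polarX.
  have -> : (n.+1%:R ^+ 2)^-1 = ((n.+1%:R ^+ 2)^-1 : R)%:C :> R[i].
    by rewrite fmorphV rmorphXn/= rmorph_nat.
  rewrite /cos_coef /sin_div_pow; simpc.
  apply/eqP; rewrite eq_complex/=; apply/andP.
  by split; apply/eqP; ring.
suff -> : dilog (r%:C * (cos phi +i* sin phi)) =
    limn u +i* sin_polylog phi 2 r.
  by [].
rewrite /dilog E; apply: (@cvg_lim R[i]^o); first exact: norm_hausdorff.
exact: cvg_complex.
Qed.

(** The points have modulus [1 / w], [w / 2] and argument [- pi / 6], [pi / 6],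
    where [w] is the square root of 3. *)
Lemma Im_dilog_points (R : realType) :
  complex.Im (dilog ((3 - 'i%C * (Num.sqrt 3)%:C) / 6))
    + complex.Im (dilog ((3 + 'i%C * (Num.sqrt 3)%:C) / 4)) =
  sin_polylog (pi / 6) 2 (Num.sqrt 3 / 2)
    - sin_polylog (pi / 6) 2 (Num.sqrt 3)^-1 :> R.
Proof.
have w0 := sqrt3_gt0 R; have ww := sqrt3_sqr R.
have wn0 : (Num.sqrt 3)%:C != 0 :> R[i].
  by rewrite -(rmorph0 (real_complex R)) (inj_eq (@complexI R)) gt_eqF.
have wwC : (Num.sqrt 3)%:C ^+ 2 = 3 :> R[i].
  by rewrite -rmorphXn/= ww rmorph_nat.
have wr : Num.sqrt 3 / 2 < 1 :> R by nra.
have wr' : (Num.sqrt 3)^-1 < 1 :> R by rewrite invf_lt1//; nra.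
have E (x y : R) : x +i* y = x%:C + 'i%C * y%:C by exact: complexE.
have z1E : (3 - 'i%C * (Num.sqrt 3)%:C) / 6 =
    ((Num.sqrt 3)^-1)%:C * (cos (- (pi / 6)) +i* sin (- (pi / 6))) :> R[i].
  rewrite cosN sinN cos_pi6 sin_pi6 E fmorphV !rmorphM rmorphN !rmorphM/=.
  rewrite !fmorphV !rmorph_nat rmorph1 -{1}wwC.
  have -> : ((Num.sqrt 3)%:C)^-1 = (Num.sqrt 3)%:C / 3 :> R[i].
    by rewrite -wwC; field.
  by field.
have z2E : (3 + 'i%C * (Num.sqrt 3)%:C) / 4 =
    (Num.sqrt 3 / 2)%:C * (cos (pi / 6) +i* sin (pi / 6)) :> R[i].
  rewrite cos_pi6 sin_pi6 E !rmorphM/= !fmorphV !rmorph_nat rmorph1 -{1}wwC.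
  by field.
have b1 : 0 <= ((Num.sqrt 3)^-1 : R) < 1 by rewrite invr_ge0 ltW.
have b2 : 0 <= (Num.sqrt 3 / 2 : R) < 1 by rewrite divr_ge0// ltW.
have I1 : complex.Im (dilog ((3 - 'i%C * (Num.sqrt 3)%:C) / 6)) =
    - sin_polylog (pi / 6) 2 (Num.sqrt 3)^-1 :> R.
  rewrite z1E (Im_dilog_polar (- (pi / 6)) b1) sin_polylogN//.
  by case/andP: b1 => b0 b1; rewrite ger0_norm.
have I2 : complex.Im (dilog ((3 + 'i%C * (Num.sqrt 3)%:C) / 4)) =
    sin_polylog (pi / 6) 2 (Num.sqrt 3 / 2) :> R.
  by rewrite z2E (Im_dilog_polar (pi / 6) b2).
exact: etrans (congr2 +%R I1 I2) (addrC _ _).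
Qed.

Lemma is_derive_sin_dilog_pi6 (R : realType) (r : R) : 0 < r < 1 ->
  is_derive r 1 (sin_polylog (pi / 6) 2)
    (atan (r / (2 - Num.sqrt 3 * r)) / r).
Proof.
move=> r01; have w0 := sqrt3_gt0 R; have ww := sqrt3_sqr R.
have D0 : 0 < 2 - Num.sqrt 3 * r by nra.
have -> : r / (2 - Num.sqrt 3 * r) =
    r * sin (pi / 6) / (1 - r * cos (pi / 6)).
  rewrite sin_pi6 cos_pi6.
  have -> : 1 - r * (Num.sqrt 3 / 2) = (2 - Num.sqrt 3 * r) / 2 by field.
  by field; rewrite gt_eqF.
exact: is_derive_sin_dilog.
Qed.

(** * Integration in slope coordinates *)

(** The measure [A |-> a * lebesgue_measure (A / a)] agrees with the Lebesgue
    measure on intervals, hence everywhere. *)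
Lemma ge0_integral_scale (R : realType) (a : R) (f : R -> \bar R) : 0 < a ->
  measurable_fun [set: R] f -> (forall y, 0 <= f y)%E ->
  (\int[lebesgue_measure]_y f y =
   \int[lebesgue_measure]_u (a%:E * f (a * u)%R))%E.
Proof.
move=> a0 mf f0.
pose scale : measurableTypeR R -> measurableTypeR R := *%R a.
have ma : measurable_fun [set: measurableTypeR R] scale.
  exact: measurable_funM.
have [pushed pushedE] : exists m : {measure set (measurableTypeR R) -> \bar R},
    m = pushforward lebesgue_measure scale :> (set _ -> \bar R).
  by unshelve eexists
    (pushforward lebesgue_measure scale : {measure set _ -> \bar R}).
pose nu : {measure set (measurableTypeR R) -> \bar R} :=
  mscale (NngNum (ltW a0)) pushed.
have E A : measurable A -> lebesgue_measure A = nu A.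
  apply: lebesgue_measure_unique => _ [[b c]] _ <-.
  rewrite /nu/= /mscale pushedE /pushforward/=.
  have -> : scale @^-1` `]b, c]%classic = `]b / a, c / a]%classic.
    apply/seteqP; split => x /=; rewrite !in_itv/= ltr_pdivrMr// ler_pdivlMr//;
      by rewrite mulrC.
  rewrite !lebesgue_measure_itv/= !lte_fin ltr_pM2r ?invr_gt0//.
  case: ifP => _; last by rewrite mule0.
  by rewrite -!EFinB -EFinM; congr EFin; field; rewrite gt_eqF.
transitivity (\int[nu]_y f y)%E.
  by apply: eq_measure_integral => A mA _; exact: E.
rewrite ge0_integral_mscale// pushedE ge0_integral_pushforward//= preimage_setT.
rewrite -ge0_integralZl//.
- exact: measurableT_comp.
- by rewrite lee_fin ltW.
Qed.

Lemma ge0_integral_even (R : realType) (f : R -> \bar R) :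
  measurable_fun [set: R] f -> (forall y, 0 <= f y)%E ->
  (forall y, f (- y) = f y) ->
  (\int[lebesgue_measure]_y f y =
   2%:E * \int[lebesgue_measure]_(y in `[0%R, +oo[) f y)%E.
Proof.
move=> mf f0 fN.
have E : [set: R] = `]-oo, 0%R[ `|` `[0%R, +oo[ :> set R.
  apply/seteqP; split => // x _ /=; rewrite !in_itv/= andbT.
  by case: (ltP x 0); [left|right].
rewrite E ge0_integral_setU//=; last 2 first.
- exact: measurable_funS mf.
- apply/disj_setPS => x [] /=; rewrite !in_itv/= andbT => x0.
  by rewrite leNgt x0.
rewrite integral_itv_bndo_bndc; last exact: measurable_funS mf.
have -> : (\int[lebesgue_measure]_(y in `]-oo, 0%R]) f y =
    \int[lebesgue_measure]_(y in `[0%R, +oo[) f y)%E.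
  rewrite ge0_integration_by_substitution0//.
  by apply: eq_integral => x _; rewrite fN.
by rewrite -mule2n mule_natl.
Qed.

Lemma measurable_slope_integrand (R : realType) (g : R * R -> \bar R) :
  measurable_fun [set: R * R] g ->
  measurable_fun [set: R * R]
    (fun p => (Num.max p.1 0)%:E * g (p.1, p.1 * p.2)%R)%E.
Proof.
move=> mg; apply: emeasurable_funM.
  by apply/measurable_EFinP; exact: measurable_maxr.
apply: (measurableT_comp mg); apply: measurable_fun_pair => //.
exact: measurable_funM.
Qed.

(** Substitute [y = x u] at fixed [x > 0] and exchange the integrals.  The
    factor [Num.max x 0] is the Jacobian [x] for [x >= 0] and vanishes for
    [x < 0], so that the inner integral can be taken over the whole line. *)
Lemma slope_coordinates (R : realType) (g : R * R -> \bar R) :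
  measurable_fun [set: R * R] g -> (forall p, 0 <= g p)%E ->
  (forall x y, g (- x, y) = g (x, y)) -> (forall x y, g (x, - y) = g (x, y)) ->
  (\int[lebesgue_measure]_x \int[lebesgue_measure]_y g (x, y) =
   4%:E * \int[lebesgue_measure]_(u in `[0%R, +oo[)
     \int[lebesgue_measure]_x ((Num.max x 0)%:E * g (x, x * u)%R))%E.
Proof.
move=> mg g0 gNx gNy.
pose h (p : R * R) := ((Num.max p.1 0)%:E * g (p.1, p.1 * p.2)%R)%E.
have h0 p : (0 <= h p)%E by rewrite mule_ge0// lee_fin le_max lexx orbT.
have mh : measurable_fun [set: R * R] h by exact: measurable_slope_integrand.
have mgx x : measurable_fun [set: R] (fun y => g (x, y)).
  exact: measurableT_comp.
have mG : measurable_fun [set: R]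
    (fun x => \int[lebesgue_measure]_y g (x, y))%E.
  exact: (measurable_fun_fubini_tonelli_F (m2 := lebesgue_measure)).
have mK : measurable_fun [set: R]
    (fun u => \int[lebesgue_measure]_x h (x, u))%E.
  exact: (measurable_fun_fubini_tonelli_G (m1 := lebesgue_measure)).
rewrite ge0_integral_even//; last 2 first.
- by move=> x; exact: integral_ge0.
- by move=> x; apply: eq_integral => y _; rewrite gNx.
have -> : (\int[lebesgue_measure]_(x in `[0%R, +oo[)
    \int[lebesgue_measure]_y g (x, y) =
    \int[lebesgue_measure]_x \int[lebesgue_measure]_u h (x, u))%E.
  rewrite -integral_itv_obnd_cbnd; last exact: measurable_funS mG.
  rewrite integral_mkcond; apply: eq_integral => x _.
  rewrite patchE; case: ifPn => [|/negP]; rewrite inE/= in_itv/= andbT => x0.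
    rewrite (ge0_integral_scale x0)//; apply: eq_integral => u _.
    by rewrite /h/= max_l// ltW.
  rewrite integral0_eq// => u _.
  by rewrite /h/= max_r ?mul0e// leNgt; exact/negP.
rewrite (fubini_tonelli (m1 := lebesgue_measure) (m2 := lebesgue_measure))//.
rewrite ge0_integral_even//; last 2 first.
- by move=> x; exact: integral_ge0.
- by move=> u; apply: eq_integral => x _; rewrite /h/= mulrN gNy.
by rewrite muleA -EFinM -natrM.
Qed.

(** * Integration along the fibers *)

(** The hexagon is in fact inside the disk of radius [1 / w], the distance from
    the origin to the vertices. *)
Lemma hexagon_lt1 (R : realType) (p : R * R) : hexagon p ->
  p.1 ^+ 2 + p.2 ^+ 2 < 1.
Proof.
move=> [h1 h2].
rewrite -(real_normK (num_real p.1)) -(real_normK (num_real p.2)).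
have := normr_ge0 p.1; have := normr_ge0 p.2.
have := sqrt3_sqr R; have := sqrt3_gt0 R.
move: h1 h2; set w := Num.sqrt 3; set a := `|p.1|; set b := `|p.2|.
move=> h1 h2 w0 ww b0 a0.
have : (w * b) ^+ 2 <= (1 - a) ^+ 2.
  by apply: lerXn2r; rewrite ?nnegrE; nra.
rewrite exprMn ww; nra.
Qed.

Lemma integral_fiber (R : realType) (s : R) : s < 1 ->
  (\int[lebesgue_measure]_(t in
       [set t : R | (0 < t)%R /\ (1 - 1 / t ^+ 4 <= s)%R])
     (t ^+ 3)%:E = (4^-1 / (1 - s))%:E)%E.
Proof.
move=> s1; have k0 : 0 < (1 - s)^-1 by rewrite invr_gt0 subr_gt0.
pose T : R := Num.sqrt (Num.sqrt (1 - s)^-1).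
have T0 : 0 < T by rewrite !sqrtr_gt0.
have T4 : T ^+ 4 = (1 - s)^-1.
  by rewrite (exprM T 2 2) !sqr_sqrtr ?sqrtr_ge0// ltW.
have -> : [set t : R | 0 < t /\ 1 - 1 / t ^+ 4 <= s] = `]0, T]%classic.
  apply/seteqP; split => t /=; rewrite in_itv/=.
    move=> [t0]; rewrite t0/= lerBlDl -lerBlDr ler_pdivlMr ?exprn_gt0//.
    rewrite -ler_pdivlMl ?subr_gt0// mulr1 -T4 => tT.
    by rewrite -(@ler_pXn2r _ 4)// ?nnegrE ltW.
  move=> /andP[t0 tT]; split => //.
  rewrite lerBlDl -lerBlDr ler_pdivlMr ?exprn_gt0//.
  rewrite -ler_pdivlMl ?subr_gt0// mulr1 -T4.
  by apply: lerXn2r; rewrite ?nnegrE// ltW.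
have mt : measurable_fun setT (fun t : R => (t ^+ 3)%:E).
  by apply/measurable_EFinP; exact: exprn_measurable.
rewrite integral_itv_obnd_cbnd; last exact: measurable_funS mt.
have c3 (x : R) : 0 <= x <= T -> {for x, continuous (fun t : R => t ^+ 3)}.
  by move=> _; exact: exprn_continuous.
have d4 (x : R) : 0 <= x <= T -> is_derive x 1 (fun t => t ^+ 4 / 4) (x ^+ 3).
  by move=> _; differentiate; rewrite /=; field.
rewrite (integral_is_derive T0 c3 d4) T4 expr0n/= mul0r subr0.
by rewrite [in LHS]mulrC.
Qed.

Lemma measurable_set_le (R : realType) d (T : measurableType d) (f g : T -> R) :
  measurable_fun setT f -> measurable_fun setT g ->
  measurable [set x | f x <= g x].
Proof.
move=> mf mg; have -> : [set x | f x <= g x] =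
    setT `&` (fun x => f x <= g x) @^-1` [set true] by rewrite setTI.
exact: measurable_fun_ler.
Qed.

Lemma measurable_set_lt (R : realType) d (T : measurableType d) (f g : T -> R) :
  measurable_fun setT f -> measurable_fun setT g ->
  measurable [set x | f x < g x].
Proof.
move=> mf mg; have -> : [set x | f x < g x] =
    setT `&` (fun x => f x < g x) @^-1` [set true] by rewrite setTI.
exact: measurable_fun_ltr.
Qed.

(** After clearing the denominator [t^4] every condition compares polynomial
    expressions in the coordinates and their absolute values. *)
Lemma measurable_reduced_domain (R : realType) :
  measurable (@reduced_domain R :
    set (measurableTypeR R * (measurableTypeR R * measurableTypeR R))).
Proof.
pose T : measurableType _ :=
  (measurableTypeR R * (measurableTypeR R * measurableTypeR R))%type.
have mt : measurable_fun setT (fun p : T => p.1 : R) by exact: measurable_fst.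
have mx : measurable_fun setT (fun p : T => p.2.1 : R).
  exact: (measurableT_comp measurable_fst measurable_snd).
have my : measurable_fun setT (fun p : T => p.2.2 : R).
  exact: (measurableT_comp measurable_snd measurable_snd).
have max : measurable_fun setT (fun p : T => `|p.2.1| : R).
  exact: measurableT_comp.
have may : measurable_fun setT (fun p : T => `|p.2.2| : R).
  exact: measurableT_comp.
have -> : @reduced_domain R = [set p : T | (0 : R) < p.1] `&`
   ([set p : T | `|p.2.1| <= (2^-1 : R)] `&`
    [set p : T | Num.sqrt 3 * `|p.2.2| + `|p.2.1| <= (1 : R)]) `&`
   [set p : T | (1 - (p.2.1 ^+ 2 + p.2.2 ^+ 2)) * p.1 ^+ 4 <= (1 : R)].
  apply/seteqP; split => p.
    move=> [p0 [p1 p2] p3]; split => //=.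
    move: p3; rewrite lerBlDl -lerBlDr ler_pdivlMr ?exprn_gt0//.
  move=> [[/= p0 [p1 p2]] p3]; split => //.
  by rewrite lerBlDl -lerBlDr ler_pdivlMr ?exprn_gt0.
apply: measurableI; [apply: measurableI; [|apply: measurableI]|].
- exact: measurable_set_lt.
- exact: measurable_set_le.
- apply: measurable_set_le => //; apply: measurable_funD => //.
  exact: measurable_funM.
- apply: measurable_set_le => //; apply: measurable_funM.
    apply: measurable_funB => //.
    by apply: measurable_funD; exact: measurable_funX.
  exact: measurable_funX.
Qed.

(** The result of integrating [t^3] over the fiber of the domain above a point
    of the plane; the restriction extends it by 0 outside the hexagon. *)
Definition fiber_volume (R : realType) (p : R * R) : \bar R :=
  ((fun q : R * R => (4^-1 / (1 - (q.1 ^+ 2 + q.2 ^+ 2)))%:E)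
     \_ (@hexagon R)) p.

Lemma fiber_volume_ge0 (R : realType) (p : R * R) :
  (0 <= fiber_volume p)%E.
Proof.
rewrite /fiber_volume patchE; case: ifPn => //; rewrite inE => hp.
by rewrite lee_fin divr_ge0// subr_ge0 ltW// hexagon_lt1.
Qed.

Lemma fiber_volumeE (R : realType) (p : R * R) :
  (\int[lebesgue_measure]_t
    (((fun q : R * (R * R) => (q.1 ^+ 3)%:E) \_ (@reduced_domain R)) (t, p)) =
  fiber_volume p)%E.
Proof.
rewrite /fiber_volume patchE; case: ifPn => [|/negP]; rewrite inE => hp.
  rewrite -integral_fiber ?hexagon_lt1// [RHS]integral_mkcond.
  apply: eq_integral => t _; rewrite !patchE; congr (if _ then _ else _).
  by apply/idP/idP; rewrite !inE => -[].
apply: integral0_eq => t _; rewrite patchE ifF//; apply/negP.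
by rewrite inE => -[].
Qed.

(** The measurability of [fiber_volume] is recorded here because it comes from
    its expression as a partial integral. *)
Lemma integral_reduced_domain (R : realType) :
  (\int[lebesgue_measure \x @lebesgue2 R]_(p in @reduced_domain R)
     (p.1 ^+ 3)%:E =
   \int[lebesgue_measure]_x \int[lebesgue_measure]_y fiber_volume (x, y))%E
  /\ measurable_fun [set: R * R] (@fiber_volume R).
Proof.
have mD := @measurable_reduced_domain R.
pose f :=
  ((fun q : measurableTypeR R * (measurableTypeR R * measurableTypeR R) =>
      (q.1 ^+ 3)%:E) \_ (@reduced_domain R)).
have mf : measurable_fun setT f.
  apply/(measurable_restrictT _ mD).
  apply/measurable_EFinP; apply: measurable_funX.
  by apply: measurable_funS measurable_fst.
have f0 q : (0 <= f q)%E.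
  rewrite /f patchE; case: ifPn => //; rewrite inE => -[q0 _ _].
  by rewrite lee_fin exprn_ge0// ltW.
have gE : (fun p => \int[lebesgue_measure]_t f (t, p))%E = @fiber_volume R.
  by apply/funext => p; exact: fiber_volumeE.
have mg : measurable_fun setT (@fiber_volume R).
  have := measurable_fun_fubini_tonelli_G (m1 := lebesgue_measure) f mf f0.
  by rewrite /fubini_G gE.
split; last exact: mg.
rewrite integral_mkcond.
rewrite (fubini_tonelli2 (m1 := lebesgue_measure) (m2 := @lebesgue2 R) f)//.
rewrite /fubini_G gE.
rewrite (fubini_tonelli1 (m1 := lebesgue_measure) (m2 := lebesgue_measure))//.
by move=> p; exact: fiber_volume_ge0.
Qed.

(** * Integration over the hexagon *)

Lemma fiber_volumeNx (R : realType) (x y : R) :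
  fiber_volume (- x, y) = fiber_volume (x, y).
Proof.
rewrite /fiber_volume !patchE/= sqrrN; congr (if _ then _ else _).
by apply/idP/idP; rewrite !inE /hexagon/= normrN.
Qed.

Lemma fiber_volumeNy (R : realType) (x y : R) :
  fiber_volume (x, - y) = fiber_volume (x, y).
Proof.
rewrite /fiber_volume !patchE/= sqrrN; congr (if _ then _ else _).
by apply/idP/idP; rewrite !inE /hexagon/= normrN.
Qed.

Lemma hexagon_slope (R : realType) (x u : R) : 0 <= x -> 0 <= u ->
  hexagon (x, x * u) <-> x <= 2^-1 /\ x <= (1 + Num.sqrt 3 * u)^-1.
Proof.
move=> x0 u0; rewrite /hexagon/= !ger0_norm ?mulr_ge0//.
have d0 : 0 < 1 + Num.sqrt 3 * u.
  by rewrite ltr_pwDl// mulr_ge0// ltW// sqrt3_gt0.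
rewrite -[X in _ <-> _ /\ _ <= X]mul1r ler_pdivlMr//.
have -> : x * (1 + Num.sqrt 3 * u) = Num.sqrt 3 * (x * u) + x by ring.
by [].
Qed.

(** Here [rho] is the abscissa at which the half-line of slope [u] leaves the
    hexagon. *)
Lemma radial_integral (R : realType) (u rho : R) : 0 < rho ->
  (forall x, 0 <= x -> hexagon (x, x * u) <-> x <= rho) ->
  (\int[lebesgue_measure]_x
     ((Num.max x 0)%:E * fiber_volume (x, x * u)%R) =
   (- 8^-1 * ln (1 - (1 + u ^+ 2) * rho ^+ 2) / (1 + u ^+ 2))%:E)%E.
Proof.
move=> rho0 hex.
have q0 : 0 < 1 + u ^+ 2 by rewrite ltr_pwDl// sqr_ge0.
have D0 (x : R) : 0 <= x <= rho -> 0 < 1 - (1 + u ^+ 2) * x ^+ 2.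
  move=> /andP[x0 xr]; have /hexagon_lt1/= := (hex x x0).2 xr.
  by rewrite exprMn; lra.
pose f x : R := x / (4 * (1 - (1 + u ^+ 2) * x ^+ 2)).
pose F x : R := - 8^-1 * ln (1 - (1 + u ^+ 2) * x ^+ 2) / (1 + u ^+ 2).
have dF (x : R) : 0 <= x <= rho -> is_derive x 1 F (f x).
  move=> /D0 Dx; rewrite /F /f; differentiate; rewrite /=; field.
  by rewrite !gt_eqF.
have cf (x : R) : 0 <= x <= rho -> {for x, continuous f}.
  move=> /D0 Dx; rewrite /f; eapply is_derive_continuous; differentiate.
    by rewrite gt_eqF// mulr_gt0.
  reflexivity.
transitivity (\int[lebesgue_measure]_(x in `[0%R, rho]) (f x)%:E)%E.
  rewrite [RHS]integral_mkcond; apply: eq_integral => x _.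
  rewrite /fiber_volume !patchE/=.
  have [x0|x0] := leP 0 x; last first.
    rewrite mul0e ifF//; apply/negP.
    by rewrite inE/= in_itv/= leNgt x0.
  case: ifPn => [|/negP]; rewrite inE => /(hex x x0) xr.
    rewrite ifT; last by rewrite inE/= in_itv/= x0.
    have := D0 x; rewrite x0 xr => /(_ isT) Dx.
    rewrite -EFinM; congr EFin; rewrite /f exprMn.
    have -> : 1 - (x ^+ 2 + x ^+ 2 * u ^+ 2) = 1 - (1 + u ^+ 2) * x ^+ 2.
      by ring.
    by field; rewrite gt_eqF.
  by rewrite mule0 ifF//; apply/negP; rewrite inE/= in_itv/= x0.
rewrite (integral_is_derive rho0 cf dF) /F expr0n/= mulr0 subr0 ln1.
by rewrite mulr0 mul0r subr0.
Qed.

Lemma tan_pi6 (R : realType) : tan (pi / 6) = (Num.sqrt 3)^-1 :> R.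
Proof. by rewrite /tan sin_pi6 cos_pi6; field; rewrite gt_eqF// sqrt3_gt0. Qed.

Lemma atan_sqrt3V (R : realType) : atan (Num.sqrt 3)^-1 = pi / 6 :> R.
Proof.
have := pi_gt0 R => p0.
by rewrite -tan_pi6 tanK// in_itv/=; lra.
Qed.

Lemma cos_atan_gt0 (R : realType) (u : R) : 0 < cos (atan u).
Proof. by apply: cos_gt0_pihalf; rewrite atan_gtNpi2 atan_ltpi2. Qed.

Lemma sin_atan (R : realType) (u : R) : sin (atan u) = u * cos (atan u).
Proof.
transitivity (tan (atan u) * cos (atan u)); last by rewrite atanK.
by rewrite /tan divfK// gt_eqF// cos_atan_gt0.
Qed.

Lemma is_derive_comp_atan (R : realType) (c : R -> R) (k u : R) :
  odd_primitive_logcos c -> - (pi / 3) <= atan u + k <= pi / 3 ->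
  is_derive u 1 (fun v => c (atan v + k))
    (ln (2 * cos (atan u + k)) / (1 + u ^+ 2)).
Proof.
move=> [_ dc] /dc d.
have da : is_derive u 1 (fun v => atan v + k) (1 + u ^+ 2)^-1.
  by differentiate; ring.
exact: (is_derive_lam_comp (g := fun v => atan v + k) d da).
Qed.

(** With [theta = atan u], the argument of the logarithm is
    [cos (theta + pi / 6) cos (theta - pi / 6) / cos^2 theta]. *)
Lemma integral_flat_slopes (R : realType) (c : R -> R) :
  odd_primitive_logcos c ->
  (\int[lebesgue_measure]_(u in `[0%R, (Num.sqrt 3)^-1%R])
     (- 8^-1 * ln (1 - (1 + u ^+ 2) * 2^-1 ^+ 2) / (1 + u ^+ 2))%:E =
   (- 8^-1 * (c (pi / 3) - 2 * c (pi / 6)))%:E)%E.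
Proof.
move=> hc; have codd := hc.1.
have p0 := pi_gt0 R; have w0 := sqrt3_gt0 R; have ww := sqrt3_sqr R.
set w : R := Num.sqrt 3 in w0 ww *.
have a0 : 0 < w^-1 by rewrite invr_gt0.
have aw : w^-1 * w = 1 by rewrite mulVf// gt_eqF.
pose F (u : R) := - 8^-1 * (c (atan u + pi / 6) + c (atan u + - (pi / 6))
  - 2 * c (atan u + 0)).
have D0 (u : R) : 0 <= u <= w^-1 -> 0 < 1 - (1 + u ^+ 2) * 2^-1 ^+ 2 by nra.
have q0 (u : R) : 0 < 1 + u ^+ 2 by rewrite ltr_pwDl// sqr_ge0.
have cf (u : R) : 0 <= u <= w^-1 -> {for u, continuous (fun u : R =>
    - 8^-1 * ln (1 - (1 + u ^+ 2) * 2^-1 ^+ 2) / (1 + u ^+ 2))}.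
  move=> /D0 Du; eapply is_derive_continuous; differentiate.
    by rewrite gt_eqF.
  reflexivity.
have dF (u : R) : 0 <= u <= w^-1 -> is_derive u 1 F
    (- 8^-1 * ln (1 - (1 + u ^+ 2) * 2^-1 ^+ 2) / (1 + u ^+ 2)).
  move=> /andP[u0 ua].
  have t0 : 0 <= atan u by rewrite -(atan0 R); exact: le_atan.
  have t6 : atan u <= pi / 6 by rewrite -atan_sqrt3V; exact: le_atan.
  have d1 := @is_derive_comp_atan _ _ (pi / 6) u hc ltac:(lra).
  have d2 := @is_derive_comp_atan _ _ (- (pi / 6)) u hc ltac:(lra).
  have d3 := @is_derive_comp_atan _ _ 0 u hc ltac:(lra).
  rewrite /F; differentiate.
  have C0 := cos_atan_gt0 u.
  have -> : 2 * cos (atan u + pi / 6) = cos (atan u) * (w - u).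
    by rewrite cosD cos_pi6 sin_pi6 sin_atan /w; field.
  have -> : 2 * cos (atan u - pi / 6) = cos (atan u) * (w + u).
    by rewrite cosB cos_pi6 sin_pi6 sin_atan /w; field.
  have wu : 0 < w - u by nra.
  have wu' : 0 < w + u by nra.
  have -> : 1 - (1 + u ^+ 2) * 2^-1 ^+ 2 = (w - u) * (w + u) / (2 * 2).
    have -> : (w - u) * (w + u) = 3 - u ^+ 2 by rewrite -ww; ring.
    by field.
  rewrite addr0 ln_div ?posrE ?mulr_gt0// !lnM ?posrE ?mulr_gt0//.
  by field; rewrite gt_eqF.
rewrite (integral_is_derive a0 cf dF) /F atan_sqrt3V atan0.
congr EFin.
have -> : pi / 6 + pi / 6 = pi / 3 :> R by field.
have c0 : c 0 = 0 by have := codd 0; rewrite oppr0; lra.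
by rewrite subrr !add0r !addr0 codd c0; ring.
Qed.

(** With [theta = atan u], the argument of the logarithm is
    [sin theta cos (theta - pi / 6) / cos^2 (theta - pi / 3)]. *)
Lemma integral_steep_slopes (R : realType) (c : R -> R) :
  odd_primitive_logcos c ->
  (\int[lebesgue_measure]_(u in `[(Num.sqrt 3)^-1%R, +oo[)
     (- 8^-1 * ln (1 - (1 + u ^+ 2) * (1 + Num.sqrt 3 * u)^-1 ^+ 2)
        / (1 + u ^+ 2))%:E =
   (- 4^-1 * (c (pi / 3) - 2 * c (pi / 6)))%:E)%E.
Proof.
move=> hc; have codd := hc.1.
have p0 := pi_gt0 R; have w0 := sqrt3_gt0 R; have ww := sqrt3_sqr R.
set w : R := Num.sqrt 3 in w0 ww *.
have a0 : 0 < w^-1 by rewrite invr_gt0.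
pose G (t : R) := - 8^-1 * (c (t + - (pi / 2)) + c (t + - (pi / 6))
  - 2 * c (t + - (pi / 3))).
have q0 (u : R) : 0 < 1 + u ^+ 2 by rewrite ltr_pwDl// sqr_ge0.
have DE (u : R) : w^-1 <= u -> 1 - (1 + u ^+ 2) * (1 + w * u)^-1 ^+ 2 =
    (2 * u) * (w + u) / ((1 + w * u) * (1 + w * u)).
  move=> au; have u0 : 0 < u by exact: lt_le_trans au.
  have -> : 2 * u * (w + u) = (1 + w * u) ^+ 2 - (1 + u ^+ 2).
    have -> : (1 + w * u) ^+ 2 = 1 + 2 * w * u + w ^+ 2 * u ^+ 2 by ring.
    by rewrite ww; ring.
  by field; rewrite gt_eqF// ltr_pwDl// mulr_ge0// ltW.
have D0 (u : R) : w^-1 <= u -> 0 < 1 - (1 + u ^+ 2) * (1 + w * u)^-1 ^+ 2.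
  move=> au; rewrite DE//; have u0 : 0 < u by exact: lt_le_trans au.
  have ? : 0 < 1 + w * u by rewrite ltr_pwDl// mulr_ge0// ltW.
  by rewrite divr_gt0 ?mulr_gt0// addr_gt0.
have cf (u : R) : w^-1 <= u -> {for u, continuous (fun u : R =>
    - 8^-1 * ln (1 - (1 + u ^+ 2) * (1 + w * u)^-1 ^+ 2) / (1 + u ^+ 2))}.
  move=> au; have Du := D0 u au; have u0 : 0 < u by exact: lt_le_trans au.
  have wu : 1 + w * u != 0 by rewrite gt_eqF// ltr_pwDl// mulr_ge0// ltW.
  have qn0 : 1 + u ^+ 2 != 0 by rewrite gt_eqF.
  by eapply is_derive_continuous; differentiate; reflexivity.
have f0 (u : R) : w^-1 <= u ->
    0 <= - 8^-1 * ln (1 - (1 + u ^+ 2) * (1 + w * u)^-1 ^+ 2) / (1 + u ^+ 2).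
  move=> au; apply: mulr_ge0; last by rewrite invr_ge0 ltW.
  rewrite mulNr oppr_ge0 pmulr_rle0//.
  by rewrite ln_le0// gerBl mulr_ge0 ?sqr_ge0// ltW.
have dF (u : R) : w^-1 <= u -> is_derive u 1 (fun u => G (atan u))
    (- 8^-1 * ln (1 - (1 + u ^+ 2) * (1 + w * u)^-1 ^+ 2) / (1 + u ^+ 2)).
  move=> au; have u0 : 0 < u by exact: lt_le_trans au.
  have t6 : pi / 6 <= atan u by rewrite -atan_sqrt3V; exact: le_atan.
  have t2 := atan_ltpi2 u.
  have d1 := @is_derive_comp_atan _ _ (- (pi / 2)) u hc ltac:(lra).
  have d2 := @is_derive_comp_atan _ _ (- (pi / 6)) u hc ltac:(lra).
  have d3 := @is_derive_comp_atan _ _ (- (pi / 3)) u hc ltac:(lra).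
  rewrite /G; differentiate.
  have C0 := cos_atan_gt0 u.
  have -> : 2 * cos (atan u - pi / 2) = cos (atan u) * (2 * u).
    by rewrite cosB cos_pihalf sin_pihalf sin_atan; ring.
  have -> : 2 * cos (atan u - pi / 6) = cos (atan u) * (w + u).
    by rewrite cosB cos_pi6 sin_pi6 sin_atan /w; field.
  have -> : 2 * cos (atan u - pi / 3) = cos (atan u) * (1 + w * u).
    by rewrite cosB cos_pi3 sin_pi3 sin_atan /w; field.
  have wu : 0 < 1 + w * u by rewrite ltr_pwDl// mulr_ge0// ltW.
  have wu' : 0 < w + u by rewrite addr_gt0.
  have u20 : 0 < 2 * u by rewrite mulr_gt0.
  rewrite DE// ln_div ?posrE ?mulr_gt0// !(lnM C0)// !lnM ?posrE ?mulr_gt0//.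
  by field; rewrite gt_eqF.
have Gl : G (atan u) @[u --> +oo] --> G (pi / 2).
  apply: continuous_cvg; last exact: cvgy_atan.
  have dc := hc.2.
  have d1 := dc (pi / 2 - pi / 2) ltac:(lra).
  have d2 := dc (pi / 2 - pi / 6) ltac:(lra).
  have d3 := dc (pi / 2 - pi / 3) ltac:(lra).
  have ds (k : R) : is_derive (pi / 2) 1 (fun t => t + - k) 1.
    by differentiate; ring.
  have e1 := is_derive_lam_comp (g := fun t => t + - (pi / 2)) d1 (ds _).
  have e2 := is_derive_lam_comp (g := fun t => t + - (pi / 6)) d2 (ds _).
  have e3 := is_derive_lam_comp (g := fun t => t + - (pi / 3)) d3 (ds _).
  by rewrite /G; eapply is_derive_continuous; differentiate; reflexivity.
rewrite (integral_is_derivey f0 cf dF Gl) atan_sqrt3V /G.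
congr EFin.
have -> : pi / 2 - pi / 6 = pi / 3 :> R by field.
have -> : pi / 2 - pi / 3 = pi / 6 :> R by field.
have -> : pi / 6 - pi / 2 = - (pi / 3) :> R by field.
have -> : pi / 6 - pi / 3 = - (pi / 6) :> R by field.
rewrite !subrr !codd.
have c0 : c 0 = 0 by have := codd 0; rewrite oppr0; lra.
by rewrite c0; field.
Qed.

Lemma hexagon_volume (R : realType) (c : R -> R) : odd_primitive_logcos c ->
  (\int[lebesgue_measure \x @lebesgue2 R]_(p in @reduced_domain R)
     (p.1 ^+ 3)%:E = (- (3 / 2) * (c (pi / 3) - 2 * c (pi / 6)))%:E)%E.
Proof.
move=> hc; have [-> mg] := integral_reduced_domain R.
have w0 := sqrt3_gt0 R.
have g0 := @fiber_volume_ge0 R.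
rewrite slope_coordinates//; last 2 first.
- exact: fiber_volumeNx.
- exact: fiber_volumeNy.
set K := (fun u : R => \int[_]_x _)%E.
have h0 (p : R * R) :
    (0 <= (Num.max p.1 0)%:E * fiber_volume (p.1, p.1 * p.2)%R)%E.
  by rewrite mule_ge0// lee_fin le_max lexx orbT.
have mK : measurable_fun [set: R] K.
  exact: (measurable_fun_fubini_tonelli_G (m1 := lebesgue_measure) _
    (measurable_slope_integrand mg) h0).
have K0 u : (0 <= K u)%E.
  by apply: integral_ge0 => x _; exact: (h0 (x, u)).
set w : R := Num.sqrt 3 in w0 *.
have a0 : 0 < w^-1 by rewrite invr_gt0.
have -> : `[0%R, +oo[%classic = `[0%R, w^-1%R[ `|` `[w^-1%R, +oo[ :> set R.
  apply/seteqP; split => x /=; rewrite !in_itv/= !andbT.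
    by move=> x0; case: (ltP x w^-1) => xw; [left; rewrite x0|right].
  by move=> [/andP[]//|]; apply: le_trans; exact: ltW.
rewrite ge0_integral_setU//; last 3 first.
- exact: measurable_funS mK.
- by move=> u _; exact: K0.
- apply/disj_setPS => x [] /=; rewrite !in_itv/= andbT => /andP[_ xw].
  by rewrite leNgt xw.
rewrite integral_itv_bndo_bndc; last exact: measurable_funS mK.
have -> : (\int[lebesgue_measure]_(u in `[0%R, w^-1%R]) K u =
    (- 8^-1 * (c (pi / 3) - 2 * c (pi / 6)))%:E)%E.
  rewrite -integral_flat_slopes//; apply: eq_integral => u.
  rewrite inE/= in_itv/= => /andP[u0 uw].
  apply: radial_integral => // x x0; split.
    by move=> /(hexagon_slope x0 u0)[].
  move=> x2; apply/hexagon_slope => //; split => //.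
  apply: (le_trans x2); rewrite lef_pV2 ?posrE//; last first.
    by rewrite ltr_pwDl// mulr_ge0// ltW.
  have : w * u <= 1 by rewrite -(divff (lt0r_neq0 w0)) ler_pM2l.
  by rewrite -/w; lra.
have -> : (\int[lebesgue_measure]_(u in `[w^-1%R, +oo[) K u =
    (- 4^-1 * (c (pi / 3) - 2 * c (pi / 6)))%:E)%E.
  rewrite -integral_steep_slopes//; apply: eq_integral => u.
  rewrite inE/= in_itv/= andbT => uw.
  have u0 : 0 < u by exact: lt_le_trans uw.
  have d0 : 0 < 1 + w * u by rewrite ltr_pwDl// mulr_ge0// ltW.
  apply: radial_integral; first by rewrite invr_gt0.
  move=> x x0; split.
    by move=> /(hexagon_slope x0 (ltW u0))[].
  move=> x2; apply/hexagon_slope => //; first exact: ltW.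
  split => //; apply: (le_trans x2); rewrite lef_pV2 ?posrE//.
  have : 1 <= w * u by rewrite -(divff (lt0r_neq0 w0)) ler_pM2l.
  by rewrite -/w; lra.
by rewrite -EFinD -EFinM; congr EFin; field.
Qed.

Theorem proposition19 (R : realType) :
  (\int[lebesgue_measure \x @lebesgue2 R]_(p in @reduced_domain R)
     (p.1 ^+ 3)%:E)%E =
  (pi / 2 * ln 2 - 3 * pi / 8 * ln 3
   + 3 / 2 * (complex.Im (dilog ((3 - 'i%C * (Num.sqrt 3)%:C) / 6))
            + complex.Im (dilog ((3 + 'i%C * (Num.sqrt 3)%:C) / 4))))%:E.
Proof.
have [c hc] := odd_primitive_logcos_exists R.
rewrite (hexagon_volume hc) Im_dilog_points.
rewrite (ray_increment hc (@is_derive_sin_dilog_pi6 R)).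
congr EFin; rewrite ln_div ?posrE ?sqrt3_gt0//.
have -> : ln 3 = 2 * ln (Num.sqrt 3) :> R.
  by rewrite -{1}(sqrt3_sqr R) expr2 lnM ?posrE ?sqrt3_gt0//; ring.
by field.
Qed.
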